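(* Consider training Consistency Flow Matching on segment $i$, which is defined on the time interval $[S,T]$. Assume there exists a ground truth velocity field $u_t=u(t,\cdot)$ that generates the probability path $p_t$ and satisfies the continuity equation $\partial_t p_t(x)=-\nabla\cdot(u(t,x)p_t(x))$. Let $v^*(t,x)$ denote the oracle consistent velocity such that $$x_T=x_t+(T-t)\,v^*(t,x_t).$$ Then the learned $v_\theta^i(t,x_t)$ that minimizes the multi-segment velocity consistency objective $\mathcal L_\theta$ (given in the context) in segment $i$, at time $t\in[S,T-\Delta t]$, has the following error: $$\begin{aligned} v_\theta^i(t,x_t) - v^*(t,x_t) =& \frac{\alpha}{(T-t)^2+\alpha}\big(v^*(t+\Delta t, x_{t+\Delta t})-v^*(t, x_{t})\big) \\ & + \frac{(T-t-\Delta t)(T-t) +\alpha}{(T-t)^2+\alpha}\big(v_\theta^i(t+\Delta t,x_{t+\Delta t}) - v^*(t+\Delta t,x_{t+\Delta t})\big).\end{aligned}$$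
   Context: The data space is $\mathbb{R}^d$, and $(p_t)_{t\in[0,1]}$ is a probability path on it from a noise distribution $p_0$ to a data distribution $p_1$. The velocity field $u:[0,1]\times\mathbb{R}^d\to\mathbb{R}^d$ generates $p_t$ through the ODE $\frac{dx_t}{dt}=u(t,x_t)$; $x_t$, $x_{t+\Delta t}$, $x_T$ denote points at the indicated times on the same trajectory of this ODE, with $x_t\sim p_t$. Multi-segment Consistency Flow Matching: for a number of segments $K$, $[0,1]$ is divided into the equal segments $[i/K,(i+1)/K]$, $i=0,\dots,K-1$, and on segment $i$, written $[S,T]$ with $S=i/K$ and $T=(i+1)/K$, a vector field $v_\theta^i(t,x)\in\mathbb{R}^d$ with parameters $\theta$ is learned. The training objective is $$\mathcal L_\theta=E_{t\sim\mathcal U^i}\,\lambda^i\,E_{x_t,x_{t+\Delta t}}\Big[\|f_\theta^i(t,x_t)-f_{\theta^-}^i(t+\Delta t,x_{t+\Delta t})\|_2^2+\alpha\,\|v_\theta^i(t,x_t)-v_{\theta^-}^i(t+\Delta t,x_{t+\Delta t})\|_2^2\Big],$$ $$f_\theta^i(t,x_t)=x_t+(T-t)\,v_\theta^i(t,x_t).$$ Here $\mathcal U^i$ is the uniform distribution on $[S,T-\Delta t]$; $\Delta t$ is a small positive constant; $\alpha$ is a positive scalar; $\lambda^i$ is a positive weighting scalar for segment $i$; $\theta^-$ denotes the running average of past values of $\theta$ using exponential moving average; and $x_t,x_{t+\Delta t}$ follow a pre-defined distribution.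
   Formalization: Assumes θ and its average θ⁻ converge (else v_θ⁻ appears on the right), the minimum is finite and equals that over all measurable fields, and the ODE has a continuous non-crossing flow; the formula holds a.e. in t and x_t, and everywhere on the support if v_θ is continuous. *)

(* Defs.v *)
From HB Require Import structures.
From mathcomp Require Import all_boot all_order all_algebra.
From mathcomp Require Import all_classical all_reals all_analysis.

Set Implicit Arguments.
Unset Strict Implicit.
Unset Printing Implicit Defensive.

Import Order.TTheory GRing.Theory Num.Theory.
Import numFieldNormedType.Exports.

Local Open Scope classical_set_scope.
Local Open Scope ring_scope.

Definition rV_display : measure_display.
Proof. exact: default_measure_display. Qed.

Section measurable_rV.
Context (R : realType) (d : nat).

Let coors : 'I_d -> 'rV[R]_d -> measurableTypeR R := fun i x => x ord0 i.

Let rV_set0 : g_sigma_preimage coors set0.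
Proof. exact: sigma_algebra0. Qed.

Let rV_setC A : g_sigma_preimage coors A -> g_sigma_preimage coors (~` A).
Proof. exact: sigma_algebraC. Qed.

Let rV_bigcup (F : _^nat) : (forall i, g_sigma_preimage coors (F i)) ->
  g_sigma_preimage coors (\bigcup_i (F i)).
Proof. exact: sigma_algebra_bigcup. Qed.

(* The sigma-algebra generated by the d coordinates (as for tuples); since d is
   finite, this is the Borel sigma-algebra of R^d. *)
HB.instance Definition _ := @isMeasurable.Build rV_display
  'rV[R]_d (g_sigma_preimage coors) rV_set0 rV_setC rV_bigcup.

Lemma measurable_coor (i : 'I_d) :
  measurable_fun setT (fun x : 'rV[R]_d => x ord0 i : measurableTypeR R).
Proof.
move=> _ Y mY; rewrite setTI; apply: sub_sigma_algebra => /=.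
rewrite -bigcup_seq/=; exists i => /=; first by rewrite mem_index_enum.
by exists Y => //; rewrite setTI.
Qed.

Lemma measurable_fun_rV d1 (T : measurableType d1) (f : T -> 'rV[R]_d) :
  (forall i, measurable_fun setT (fun x => f x ord0 i : measurableTypeR R)) ->
  measurable_fun setT f.
Proof.
move=> mf.
have H : g_sigma_preimage (fun i => coors i \o f) `<=` measurable.
  apply: smallest_sub; first exact: sigma_algebra_measurable.
  elim/big_ind : _ => //; first by move=> A B hA hB C [/hA|/hB].
  by move=> i _ A [B mB <-]; exact: mf.
rewrite g_sigma_preimage_comp in H => _ A mA.
by apply: H; exists A.
Qed.

End measurable_rV.

Section lebesgue_rV.
Context (R : realType).

Definition rV_cons d (z : measurableTypeR R * 'rV[R]_d) : 'rV[R]_d.+1 :=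
  \row_j oapp (z.2 ord0) (z.1 : R) (unlift ord0 j).

Definition rV_uncons d (x : 'rV[R]_d.+1) : measurableTypeR R * 'rV[R]_d :=
  (x ord0 ord0, \row_j x ord0 (lift ord0 j)).

Lemma rV_cons0 d z : @rV_cons d z ord0 ord0 = z.1.
Proof. by rewrite mxE unlift_none. Qed.

Lemma rV_consS d z j : @rV_cons d z ord0 (lift ord0 j) = z.2 ord0 j.
Proof. by rewrite mxE liftK. Qed.

Lemma rV_consK d : cancel (@rV_cons d) (@rV_uncons d).
Proof.
move=> z; rewrite /rV_uncons rV_cons0; case: z => a x; congr pair.
by apply/rowP => j; rewrite mxE rV_consS.
Qed.

Lemma measurable_rV_cons d : measurable_fun setT (@rV_cons d).
Proof.
apply: measurable_fun_rV => i; case: (unliftP ord0 i) => [j|] ->.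
  under eq_fun do rewrite rV_consS.
  exact: (measurableT_comp (@measurable_coor R d j) measurable_snd).
under eq_fun do rewrite rV_cons0.
exact: measurable_fst.
Qed.

Lemma measurable_rV_uncons d : measurable_fun setT (@rV_uncons d).
Proof.
apply: measurable_fun_pair; first exact: measurable_coor.
apply: measurable_fun_rV => j /=.
under eq_fun do rewrite mxE.
exact: measurable_coor.
Qed.

Section lebesgue_rV_step.
Context (d : nat) (mu : {sigma_finite_measure set 'rV[R]_d -> \bar R}).

Definition lebesgue_rV_step : set 'rV[R]_d.+1 -> \bar R :=
  pushforward (lebesgue_measure \x mu)%E (@rV_cons d).

Let step_sigma_additive : semi_sigma_additive lebesgue_rV_step.
Proof.
have mc (A : set 'rV[R]_d.+1) : measurable A -> measurable (@rV_cons d @^-1` A).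
  by move=> mA; rewrite -[X in measurable X]setTI; exact: measurable_rV_cons.
move=> F mF tF mUF; rewrite /lebesgue_rV_step /pushforward preimage_bigcup.
apply: measure_semi_sigma_additive => [n||]; first exact: mc.
- apply/trivIsetP => /= i j _ _ ij; rewrite -preimage_setI.
  by move/trivIsetP : tF => /(_ _ _ _ _ ij) ->//; rewrite preimage_set0.
- by rewrite -preimage_bigcup; exact: mc.
Qed.

Let step0 : lebesgue_rV_step set0 = 0%E.
Proof. by rewrite /lebesgue_rV_step /pushforward preimage_set0 measure0. Qed.

Let step_ge0 A : (0 <= lebesgue_rV_step A)%E.
Proof. by rewrite /lebesgue_rV_step /pushforward; exact: measure_ge0. Qed.

HB.instance Definition _ :=
  isMeasure.Build _ _ _ lebesgue_rV_step step0 step_ge0 step_sigma_additive.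

Let step_sigma_finite : sigma_finite setT lebesgue_rV_step.
Proof.
have /sigma_finiteP[F [FT ndF Foo]] := sigma_finiteT (@lebesgue_measure R).
have /sigma_finiteP[G [GT ndG Goo]] := sigma_finiteT mu.
exists (fun n => @rV_uncons d @^-1` (F n `*` G n)) => [|n].
  rewrite -preimage_bigcup (_ : \bigcup_i _ = setT) ?preimage_setT//.
  apply/seteqP; split => // -[a x] _.
  have [n _ Fna] : (\bigcup_i F i) a by rewrite -FT.
  have [k _ Gkx] : (\bigcup_i G i) x by rewrite -GT.
  exists (maxn n k) => //; split => /=.
    by move: a Fna; exact/subsetPset/ndF/leq_maxl.
  by move: x Gkx; exact/subsetPset/ndG/leq_maxr.
have [mF Fnoo] := Foo n; have [mG Gnoo] := Goo n; split.
  by rewrite -[X in measurable X]setTI; apply: measurable_rV_uncons => //;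
    exact: measurableX.
rewrite /lebesgue_rV_step /pushforward -comp_preimage (_ : _ \o _ = id).
  rewrite preimage_id product_measure1E// lte_mul_pinfty// ge0_fin_numE//.
by apply/funext => z /=; rewrite rV_consK.
Qed.

HB.instance Definition _ :=
  Measure_isSigmaFinite.Build _ _ _ lebesgue_rV_step step_sigma_finite.

End lebesgue_rV_step.

(* Lebesgue measure of R^d, by R^(d+1) = R x R^d; R^0 is a point of mass 1. *)
Fixpoint lebesgue_rV d : {sigma_finite_measure set 'rV[R]_d -> \bar R} :=
  match d return {sigma_finite_measure set 'rV[R]_d -> \bar R} with
  | 0 => [the {sigma_finite_measure set _ -> \bar R} of \d_(0 : 'rV[R]_0)]
  | d'.+1 => [the {sigma_finite_measure set _ -> \bar R} of
               lebesgue_rV_step (lebesgue_rV d')]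
  end.

End lebesgue_rV.

Section probability_path.
Context (R : realType) (d : nat).
Implicit Types (u psi : R -> 'rV[R]_d -> 'rV[R]_d) (p : R -> 'rV[R]_d -> R).

(* psi t x0 is the position at time t of the trajectory of dx/dt = u(t, x)
   started at x0.  Injectivity of psi t says that the position at one time
   determines the trajectory.  The equation is imposed inside ]0, 1[, so that no
   derivative is taken at an endpoint. *)
Definition is_flow u psi : Prop :=
  [/\ forall x, psi 0 x = x,
      {within [set z : R * 'rV[R]_d | 0 <= z.1 <= 1],
        continuous (fun z => psi z.1 z.2)},
      forall (t : R) x, 0 < t < 1 -> is_derive t (1 : R) (psi ^~ x) (u t (psi t x)) &
      forall t : R, 0 <= t <= 1 -> injective (psi t)].

(* When x_0 has law P, the point psi t x_0 has density p t with respect to the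
   Lebesgue measure of R^d. *)
Definition has_densities (P : probability 'rV[R]_d R) psi p : Prop :=
  forall t : R, 0 <= t <= 1 ->
    [/\ forall x, 0 <= p t x,
        measurable_fun setT (p t : 'rV[R]_d -> measurableTypeR R) &
        forall A, measurable A ->
          P (psi t @^-1` A) = (\int[lebesgue_rV R d]_(x in A) (p t x)%:E)%E].

Definition generates u psi (P : probability 'rV[R]_d R) p : Prop :=
  is_flow u psi /\ has_densities P psi p.

Definition divergence (F : 'rV[R]_d -> 'rV[R]_d) (x : 'rV[R]_d) : R :=
  \sum_(j < d) 'D_(delta_mx ord0 j) (fun y => F y ord0 j) x.

Definition continuity_equation u p : Prop :=
  forall (t : R) x, 0 < t < 1 ->
    (forall j : 'I_d,
      derivable (fun y => (p t y *: u t y) ord0 j) x (delta_mx ord0 j)) /\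
    is_derive t (1 : R) (p ^~ x) (- divergence (fun y => p t y *: u t y) x).

Definition law_support (P : probability 'rV[R]_d R) : set 'rV[R]_d :=
  [set x | forall U, open U -> U x -> (0 < P U)%E].

End probability_path.

Section consistency.
Context (R : realType) (d : nat).
Implicit Types (psi v w : R -> 'rV[R]_d -> 'rV[R]_d).

Definition seg_start K (i : 'I_K) : R := i%:R / K%:R.
Definition seg_end K (i : 'I_K) : R := i.+1%:R / K%:R.

(* Squared Euclidean norm; the norm `|x| of 'rV[R]_d is the sup norm. *)
Definition sqnorm2 (x : 'rV[R]_d) : R := \sum_(j < d) x ord0 j ^+ 2.

Definition endpoint (T : R) v (t : R) (x : 'rV[R]_d) : 'rV[R]_d :=
  x + (T - t) *: v t x.

Definition pair_loss (T dt alpha : R) v w (t : R) (x x' : 'rV[R]_d) : R :=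
  sqnorm2 (endpoint T v t x - endpoint T w (t + dt) x') +
  alpha * sqnorm2 (v t x - w (t + dt) x').

(* v is the field being trained and w the target field (the one carrying the
   averaged parameters); x_t and x_{t+dt} lie on the trajectory of x_0 ~ P.
   The uniform law is carried by [S, T - dt]; the domain is written out because
   nothing is assumed about the fields outside the segment. *)
Definition objective (S T dt : R) (hdt : S < T - dt) (alpha lambda : R)
    (P : probability 'rV[R]_d R) psi v w : \bar R :=
  (\int[uniform_prob hdt]_(t in `[S, (T - dt)%R])
     (lambda%:E *
      \int[P]_x0 (pair_loss T dt alpha v w t (psi t x0) (psi (t + dt)%R x0))%:E))%E.

Definition measurable_field (S T : R) v : Prop :=
  measurable_fun [set z : measurableTypeR R * 'rV[R]_d | S <= (z.1 : R) <= T]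
    (fun z => v z.1 z.2).

Definition continuous_field (S T : R) v : Prop :=
  {within [set z : R * 'rV[R]_d | S <= z.1 <= T],
    continuous (fun z => v z.1 z.2)}.

(* vstar is the velocity that carries every trajectory from its position at time
   t in [S, T] to its position at time T in a straight line. *)
Definition oracle_velocity (S T : R) psi vstar : Prop :=
  forall t x0, S <= t <= T ->
    psi T x0 = psi t x0 + (T - t) *: vstar t (psi t x0).

(* thm is the exponential moving average, with decay mu, of the iterates th; its
   initial value is arbitrary. *)
Definition ema (Theta : lmodType R) (mu : R) (th thm : nat -> Theta) : Prop :=
  forall n, thm n.+1 = mu *: thm n + (1 - mu) *: th n.+1.

End consistency.

(* Main.v *)
(** The averaged parameters follow an affine recursion, so their limit is the
    limit of the iterates and the target field is the learned field v itself.
    With the target fixed, the loss of a pair (x_t, x_(t+dt)) is a quadratic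
    function of v(t, x_t) with leading coefficient (T-t)^2 + alpha, hence the sum
    of its least value and of that coefficient times the squared distance to its
    minimizer; the error formula is this minimizer rewritten with the oracle
    velocity.  The minimizer involves x_(t+dt), which is a function of (t, x_t)
    because trajectories are determined by their position at time t.  This
    function is measurable: (t, x_0) |-> (t, x_t) is continuous and injective, so
    it maps closed sets to countable unions of compact sets.  The field of
    pointwise minimizers thus competes with v, and the excess loss of v
    integrates to zero.  For a continuous v both sides are continuous in
    (t, x_0), and agree on the support of the law of x_0. *)

Require Import Defs.
From HB Require Import structures.
From mathcomp Require Import all_boot all_order all_algebra.
From mathcomp Require Import all_classical all_reals all_analysis.
From mathcomp Require Import measurable_realfun ring.
Import Order.TTheory GRing.Theory Num.Theory.
Import numFieldNormedType.Exports.
Local Open Scope classical_set_scope.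
Local Open Scope ring_scope.

(** * Borel sets of R x R^d and measurable left inverses *)

Section prod_measurability.
Context {R : realType} {d : nat}.
Local Notation E := (measurableTypeR R * 'rV[R]_d)%type.
Implicit Types (A : set (R * 'rV[R]_d)).

Lemma measurable_ball_prod (z : R * 'rV[R]_d) (e : R) : 0 < e ->
  measurable (ball z e : set E).
Proof.
move=> e0.
(* Distances are sup distances, so a ball is a box given by finitely many coordinate conditions. *)
have -> : (ball z e : set E) = ball z.1 e `*`
    \bigcap_(j in [set: 'I_d]) (fun x : 'rV[R]_d => x ord0 j) @^-1` ball (z.2 ord0 j) e.
  apply/seteqP; split => [[t x] /= [? [_ h]]|[t x] /= [? h]].
    by split => //= j _; exact: h.
  by split => //; split => // i j; rewrite (ord1 i); exact: h.
apply: measurableX; first by apply: open_measurable; exact: ball_open.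
apply: fin_bigcap_measurable => // j _; rewrite -[X in measurable X]setTI.
by apply: measurable_coor => //; apply: open_measurable; exact: ball_open.
Qed.

(** The sigma-algebra here is generated by coordinates, not by open sets. Separability links the
    two: an open set is the union of the balls inside it that have a rational center and a radius
    [1/(n+1)], and there are countably many of these. *)
Lemma open_measurable_prod A : open A -> measurable (A : set E).
Proof.
move=> oA.
pose c (q : rat * 'rV[rat]_d) : R * 'rV[R]_d := (ratr q.1, \row_j ratr (q.2 ord0 j)).
(* Balls that leave [A] are replaced by the empty set, so that the union runs over a whole countable
   type. *)
pose B (k : rat * 'rV[rat]_d * nat) : set E :=
  if pselect (ball (c k.1) k.2.+1%:R^-1 `<=` A) then ball (c k.1) k.2.+1%:R^-1
  else set0.
have -> : A = \bigcup_k B k.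
  apply/seteqP; split => [z Az|z [k _]]; last first.
    by rewrite /B; case: pselect => [kA /kA//|].
  have [e /= e0 zeA] : nbhs_ball z A by rewrite nbhs_ballE; exact: open_nbhs_nbhs.
  (* Twice the radius must stay below [e]: once to go from [z] to the rational center, once from
     there to a point of the ball. *)
  have [n ne] : exists n : nat, n.+1%:R^-1 + n.+1%:R^-1 < e :> R.
    exists (Num.truncn (2 / e)); rewrite -mulr2n -[_ *+ 2]mulr_natl ltr_pdivrMr// mulrC.
    by rewrite -ltr_pdivrMr// truncnS_gt.
  have n0 : 0 < n.+1%:R^-1 :> R by rewrite invr_gt0.
  have approx (x : R) : exists q : rat, ball x n.+1%:R^-1 (ratr q).
    have [|q] := @rat_in_itvoo R (x - n.+1%:R^-1) (x + n.+1%:R^-1).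
      by rewrite ltrD2l gtrN.
    by move=> qx; exists q; rewrite ball_itv.
  have [q1 hq1] := approx z.1.
  have /choice[q2 hq2] := fun j => approx (z.2 ord0 j).
  pose q := (q1, \row_j q2 j) : rat * 'rV[rat]_d.
  have zq : ball (c q) n.+1%:R^-1 z.
    apply: ball_sym; split => //; split => // i j.
    by rewrite (ord1 i) /c /= !mxE; exact: hq2.
  exists (q, n) => //; rewrite /B /=; case: pselect => [//|nA]; apply: nA.
  move=> y qy; apply: zeA; apply: (le_ball (ltW ne)).
  by apply: ball_triangle qy; exact: ball_sym.
apply: countable_bigcupT_measurable => // k.
rewrite /B; case: pselect => kA; last exact: measurable0.
by apply: measurable_ball_prod; rewrite invr_gt0.
Qed.

Lemma closed_measurable_prod A : closed A -> measurable (A : set E).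
Proof. by rewrite -openC => /open_measurable_prod/measurableC; rewrite setCK. Qed.

Lemma measurable_fun_rV_in {d1} {T : measurableType d1} {D : set T}
    (f : T -> 'rV[R]_d) : measurable D ->
  (forall j, measurable_fun D (fun x => f x ord0 j : measurableTypeR R)) ->
  measurable_fun D f.
Proof.
move=> mD mf; apply/measurable_restrictT => //; apply: measurable_fun_rV => j.
have /(measurable_restrictT _ mD) := mf j; congr (measurable_fun _ _).
by apply/funext => x; rewrite /patch; case: ifP => // _; rewrite mxE.
Qed.

Lemma measurable_coor_in {d1} {T : measurableType d1} {D : set T}
    (f : T -> 'rV[R]_d) j : measurable_fun D f ->
  measurable_fun D (fun x => f x ord0 j : measurableTypeR R).
Proof. by move=> mf; exact: (measurableT_comp (@measurable_coor R d j) mf). Qed.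

Lemma closed_coor_ge A (f : R * 'rV[R]_d -> 'rV[R]_d) j a : closed A ->
  {within A, continuous f} -> closed (A `&` [set z | a <= f z ord0 j]).
Proof.
move=> cA cf; rewrite closed_setSI//.
apply: (@preimage_closed (subspace A) R (fun z => f z ord0 j) [set x | a <= x]).
  move=> z _.
  apply: (@continuous_comp (subspace A) 'rV[R]_d R f (fun M => M ord0 j)).
    exact: cf.
  exact: coord_continuous.
exact: closed_ge.
Qed.

Lemma measurable_fun_ge {d1} {T : measurableType d1} {D : set T}
    (f : T -> measurableTypeR R) :
  (forall a, measurable (D `&` [set x | a <= f x])) -> measurable_fun D f.
Proof.
move=> mf; apply: (measurability (@RGenCInfty.G R)) => [|/= _ [_] [r] -> <-].
  exact: RGenCInfty.measurableE.
by rewrite preimage_itvcy; exact: mf.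
Qed.

Lemma continuous_measurable_prod A (f : R * 'rV[R]_d -> 'rV[R]_d) :
  closed A -> {within A, continuous f} -> measurable_fun (A : set E) f.
Proof.
move=> cA cf; apply: measurable_fun_rV_in; first exact: closed_measurable_prod.
move=> j; apply: measurable_fun_ge => a; apply: closed_measurable_prod.
exact: closed_coor_ge.
Qed.

Lemma closed_norm_le {V : normedModType R} (r : R) : closed [set x : V | `|x| <= r].
Proof.
apply: (@preimage_closed V R Num.norm [set s | s <= r]); last exact: closed_le.
by move=> x _; exact: norm_continuous.
Qed.

Lemma compact_norm_le_prod (r : R) : compact [set z : R * 'rV[R]_d | `|z| <= r].
Proof.
have cX : compact (`[- r, r]%classic `*` [set x : 'rV[R]_d | `|x| <= r]).
  apply: compact_setX; first exact: segment_compact.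
  apply: bounded_closed_compact.
    by exists r; split; rewrite ?num_real// => s rs x /= /le_trans; apply; exact: ltW.
  exact: closed_norm_le.
apply: (subclosed_compact _ cX).
  exact: closed_norm_le.
by move=> [t x] /=; rewrite prod_normE ge_max in_itv /= -ler_norml => /andP[].
Qed.

(* A is a countable union of compact sets, hence so is its image. *)
Lemma measurable_image_closed A (Phi : R * 'rV[R]_d -> R * 'rV[R]_d) :
  closed A -> {within A, continuous Phi} -> measurable (Phi @` A : set E).
Proof.
move=> cA cPhi; pose B n : set (R * 'rV[R]_d) := A `&` [set z | `|z| <= n%:R].
have -> : Phi @` A = \bigcup_n (Phi @` B n).
  rewrite -image_bigcup; congr (Phi @` _); apply/seteqP; split => [z Az|z [n _ []]//].
  exists (Num.truncn `|z|).+1 => //; split => //=.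
  by rewrite ltW// truncnS_gt.
apply: bigcupT_measurable => n; apply: closed_measurable_prod.
apply: compact_closed; first exact: norm_hausdorff.
apply: continuous_compact.
  by apply: continuous_subspaceW cPhi => z [].
apply: (subclosed_compact _ (@compact_norm_le_prod n%:R)); last by move=> z [].
apply: closedI => //.
exact: closed_norm_le.
Qed.

(** Within the image of [A], the points that [g] sends into a half-space [a <= x_j] form the image
    under [Phi] of a closed subset of [A], which is measurable by [measurable_image_closed]. *)
Lemma measurable_left_inverse A (Phi : R * 'rV[R]_d -> R * 'rV[R]_d) :
  closed A -> {within A, continuous Phi} -> {in A &, injective Phi} ->
  exists2 g : E -> 'rV[R]_d, measurable_fun setT g &
    forall z, A z -> g (Phi z) = z.2.
Proof.
move=> cA cPhi iPhi.
have mPhiA : measurable (Phi @` A : set E) by exact: measurable_image_closed.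
(* A preimage in [A], unique by injectivity; the default [(0, 0)] occurs only off the image of
   [A]. *)
pose s z : R * 'rV[R]_d := xget (0, 0) (A `&` [set y | Phi y = z]).
have sK z : A z -> s (Phi z) = z.
  move=> Az; rewrite /s; case: xgetP => [y _ [Ay yz]|/(_ z)].
    by apply: iPhi => //; rewrite inE.
  by case.
exists ((fun z => (s z).2) \_ (Phi @` A : set E)); last first.
  by move=> z Az; rewrite patchE mem_set ?sK//; exists z.
apply/(measurable_restrictT _ mPhiA); apply: measurable_fun_rV_in => // j.
apply: measurable_fun_ge => a.
rewrite (_ : _ `&` _ = Phi @` (A `&` [set z | a <= (z.2 : 'rV[R]_d) ord0 j])).
  apply: measurable_image_closed.
    apply: closed_coor_ge => //; apply: continuous_subspaceT => z.
    exact: cvg_snd.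
  by apply: continuous_subspaceW cPhi => z [].
apply/seteqP; split=> t.
  by move=> [[z Az <-] /=]; rewrite sK// => az; exists z.
by move=> [z [Az /= az] <-]; split; [exists z|rewrite /= sK].
Qed.
End prod_measurability.

(** * Vanishing of a nonnegative excess in simple and iterated integrals *)

Lemma ge0_integral_slack {d} {T : measurableType d} {R : realType}
    (mu : {measure set T -> \bar R}) (D : set T) (f g : T -> \bar R) :
  measurable D -> measurable_fun D f -> measurable_fun D g ->
  (forall x, D x -> (0 <= f x)%E) -> (forall x, D x -> (0 <= g x)%E) ->
  (\int[mu]_(x in D) (f x + g x) <= \int[mu]_(x in D) f x)%E ->
  (\int[mu]_(x in D) (f x + g x) < +oo)%E ->
  {ae mu, forall x, D x -> g x = 0%E}.
Proof.
move=> mD mf mg f0 g0; rewrite ge0_integralD// => le_fg fin_fg.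
apply/(ae_eq_integral_abs mu mD mg).
rewrite (eq_integral g); last by move=> x /[!inE] Dx; rewrite gee0_abs ?g0.
(* Being finite, the integral of [f] can be cancelled in [le_fg], which leaves an integral of [g]
   that is at most 0. *)
have f_fin : (\int[mu]_(x in D) f x)%E \is a fin_num.
  rewrite ge0_fin_numE ?integral_ge0//; apply: le_lt_trans fin_fg.
  by rewrite leeDl// integral_ge0.
apply/eqP; rewrite eq_le integral_ge0// andbT.
by rewrite leNgt -(lteDl _ f_fin) -leNgt.
Qed.

Section iterated.
Context {d1 d2} {T1 : measurableType d1} {T2 : measurableType d2} {R : realType}.
Variables (nu : {measure set T1 -> \bar R}) (P : {sigma_finite_measure set T2 -> \bar R}).
Variable (J : set T1).
Hypothesis mJ : measurable J.

Lemma measurable_section (f : T1 * T2 -> R) t :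
  measurable_fun (J `*` setT) f -> J t -> measurable_fun setT (fun x => f (t, x)).
Proof.
move=> mf Jt; apply: (measurable_comp _ _ mf).
- exact: measurableX.
- by move=> _ [x _ <-]; split.
- exact: pair1_measurable.
Qed.

Lemma measurable_fun_integral_section (f : T1 * T2 -> R) :
  measurable_fun (J `*` setT) f -> (forall z, 0 <= f z) ->
  measurable_fun J (fun t => \int[P]_x (f (t, x))%:E)%E.
Proof.
(* Tonelli is applied on the whole product; extension by 0 leaves the inner integrals over [t] in
   [J] unchanged. *)
move=> mf f0; pose f' := f \_ (J `*` setT).
have mf' : measurable_fun setT f'.
  by apply/(measurable_restrictT f) => //; exact: measurableX.
have f'0 z : (0 <= (EFin \o f') z)%E.
  by rewrite /= lee_fin /f' /patch; case: ifP.
have mEf' : measurable_fun setT (EFin \o f') by exact/measurable_EFinP.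
have := measurable_fun_fubini_tonelli_F (m2 := P) (EFin \o f') mEf' f'0.
move/(measurable_funTS (D := J)); apply: eq_measurable_fun => t /[!inE] Jt.
by apply: eq_integral => x _; rewrite /= /f' patchE mem_set.
Qed.

(** The outer integral yields, through [ge0_integral_slack], a zero inner integral of [g] for almost
    every [t]; a nonnegative function with zero integral then vanishes almost everywhere. *)
Lemma iterated_integral_slack (c : R) (f g : T1 * T2 -> R) : 0 < c ->
  measurable_fun (J `*` setT) f -> measurable_fun (J `*` setT) g ->
  (forall z, 0 <= f z) -> (forall z, 0 <= g z) ->
  let L h := (\int[nu]_(t in J) (c%:E * \int[P]_x (h (t, x))%:E))%E in
  (L (f \+ g)%R <= L f)%E -> (L (f \+ g)%R < +oo)%E ->
  {ae nu, forall t, J t -> {ae P, forall x, g (t, x) = 0}}.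
Proof.
move=> c0 mf mg f0 g0 L.
have mI (h : T1 * T2 -> R) : measurable_fun (J `*` setT) h -> (forall z, 0 <= h z) ->
    measurable_fun J (fun t => (c%:E * \int[P]_x (h (t, x))%:E))%E.
  move=> mh h0; apply: emeasurable_funM; first exact: measurable_cst.
  exact: measurable_fun_integral_section.
have I0 (h : T1 * T2 -> R) t : (forall z, 0 <= h z) -> (0 <= c%:E * \int[P]_x (h (t, x))%:E)%E.
  move=> h0; apply: mule_ge0; first by rewrite lee_fin ltW.
  by apply: integral_ge0 => x _; rewrite lee_fin.
have -> : L (f \+ g)%R = (\int[nu]_(t in J) (c%:E * \int[P]_x (f (t, x))%:E +
                                          c%:E * \int[P]_x (g (t, x))%:E))%E.
  apply: eq_integral => t /[!inE] Jt.
  rewrite -ge0_muleDr ?integral_ge0//; [|by move=> x _; rewrite lee_fin..].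
  congr (_ * _)%E; rewrite -ge0_integralD//.
  - by move=> x _; rewrite lee_fin.
  - by apply/measurable_EFinP; exact: measurable_section.
  - by move=> x _; rewrite lee_fin.
  - by apply/measurable_EFinP; exact: measurable_section.
move=> le_fg fin_fg.
have := ge0_integral_slack nu _ _ _ mJ (mI _ mf f0) (mI _ mg g0)
  (fun t _ => I0 _ t f0) (fun t _ => I0 _ t g0) le_fg fin_fg.
apply: filterS => t gt0 Jt; move: (gt0 Jt) => /eqP.
rewrite mule_eq0 eqe gt_eqF//= => /eqP gt.
have mgt : measurable_fun setT (fun x => (g (t, x))%:E).
  by apply/measurable_EFinP; exact: measurable_section.
have : ae_eq P setT (fun x => (g (t, x))%:E) (cst 0%E).
  apply/(ae_eq_integral_abs P measurableT mgt).
  rewrite -[RHS]gt; apply: eq_integral => x _.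
  by rewrite gee0_abs ?lee_fin.
by apply: filterS => x /(_ I)[].
Qed.
End iterated.

(** * The loss of one pair as a quadratic function *)

Section minimizer.
Context {R : realType} {d : nat}.
Implicit Types (y m : 'rV[R]_d) (v w : R -> 'rV[R]_d -> 'rV[R]_d).

(* The minimizer over m of |a m - y - b w|^2 + alpha |m - w|^2. *)
Definition loss_minimizer (alpha a b : R) (y w : 'rV[R]_d) : 'rV[R]_d :=
  (a / (a ^+ 2 + alpha)) *: y + ((a * b + alpha) / (a ^+ 2 + alpha)) *: w.

Lemma sqnorm2_ge0 y : 0 <= sqnorm2 y.
Proof. by apply: sumr_ge0 => j _; exact: sqr_ge0. Qed.

Lemma sqnorm2_eq0 y : sqnorm2 y = 0 -> y = 0.
Proof.
move=> /eqP; rewrite psumr_eq0 => [/allP y0|j _]; last exact: sqr_ge0.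
apply/rowP => j; rewrite mxE; apply/eqP; rewrite -sqrf_eq0.
by apply: y0; exact: mem_index_enum.
Qed.

(** Completion of the square in each coordinate; [alpha > 0] makes the leading coefficient
    invertible. *)
Lemma pair_loss_split (T dt alpha t : R) v w (x x' : 'rV[R]_d) : 0 < alpha ->
  let m := loss_minimizer alpha (T - t) (T - (t + dt)) (x' - x) (w (t + dt) x') in
  pair_loss T dt alpha v w t x x' =
  pair_loss T dt alpha (fun _ _ => m) w t x x' +
  ((T - t) ^+ 2 + alpha) * sqnorm2 (v t x - m).
Proof.
move=> a0 m.
have D0 : (T - t) ^+ 2 + alpha != 0 by rewrite gt_eqF// ltr_wpDl// sqr_ge0.
rewrite /pair_loss /sqnorm2 !mulr_sumr -!big_split /=; apply: eq_bigr => j _.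
rewrite /endpoint /m /loss_minimizer !mxE.
move: (v t x ord0 j) (w _ _ ord0 j) (x ord0 j) (x' ord0 j) => p q r s.
by field.
Qed.

(** Both points reach the same [xT], so [x' - x] equals [(T - t) u - (T - t - dt) u']; what remains
    is an identity of rational functions. *)
Lemma loss_minimizer_error (alpha T t dt : R) (x x' xT u u' w : 'rV[R]_d) :
  0 < alpha -> xT = x + (T - t) *: u -> xT = x' + (T - (t + dt)) *: u' ->
  loss_minimizer alpha (T - t) (T - (t + dt)) (x' - x) w - u =
  (alpha / ((T - t) ^+ 2 + alpha)) *: (u' - u) +
  (((T - t - dt) * (T - t) + alpha) / ((T - t) ^+ 2 + alpha)) *: (w - u').
Proof.
move=> a0 xT1 xT2.
have -> : x = xT - (T - t) *: u by rewrite xT1 addrK.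
have -> : x' = xT - (T - (t + dt)) *: u' by rewrite xT2 addrK.
have D0 : (T - t) ^+ 2 + alpha != 0 by rewrite gt_eqF// ltr_wpDl// sqr_ge0.
by apply/rowP => j; rewrite /loss_minimizer !mxE; field.
Qed.

End minimizer.

(** * Measurability of vector-valued expressions *)

Section rV_measurability.
Context {R : realType} {d : nat} {d1} {T : measurableType d1} {D : set T}.
Hypothesis mD : measurable D.
Implicit Types (f g : T -> 'rV[R]_d) (k : T -> measurableTypeR R).

Lemma measurable_rV_lin k1 k2 f g :
  measurable_fun D k1 -> measurable_fun D f ->
  measurable_fun D k2 -> measurable_fun D g ->
  measurable_fun D (fun z => (k1 z : R) *: f z + (k2 z : R) *: g z).
Proof.
move=> mk1 mf mk2 mg; apply: measurable_fun_rV_in => // j.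
under eq_fun do rewrite !mxE.
apply: measurable_funD; apply: measurable_funM => //; exact: measurable_coor_in.
Qed.

Lemma measurable_rVB f g :
  measurable_fun D f -> measurable_fun D g -> measurable_fun D (fun z => f z - g z).
Proof.
move=> mf mg; apply: measurable_fun_rV_in => // j.
under eq_fun do rewrite !mxE.
apply: measurable_funB; exact: measurable_coor_in.
Qed.

Lemma measurable_sqnorm2 f : measurable_fun D f ->
  measurable_fun D (fun z => sqnorm2 (f z) : measurableTypeR R).
Proof.
move=> mf; apply: measurable_sum => j; apply: measurable_funX.
exact: measurable_coor_in.
Qed.
End rV_measurability.

(** * Continuity and measurability on subsets; null sets of the uniform law *)

Lemma within_continuous_comp_in {X Y Z : topologicalType} (A : set X) (B : set Y)
    (h : X -> Y) (f : Y -> Z) :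
  {within A, continuous h} -> (forall x, A x -> B (h x)) ->
  {within B, continuous f} -> {within A, continuous (f \o h)}.
Proof.
move=> /subspace_continuousP ch hAB /subspace_continuousP cf.
apply/subspace_continuousP => x Ax W WW.
have hW := ch x Ax _ (cf (h x) (hAB x Ax) W WW).
exact: (filterS (F := nbhs x) (fun z hz Az => hz Az (hAB z Az)) hW).
Qed.

Lemma within_continuous_pair {X Y Z : topologicalType} (A : set X)
    (f : X -> Y) (g : X -> Z) :
  {within A, continuous f} -> {within A, continuous g} ->
  {within A, continuous (fun x => (f x, g x))}.
Proof. by move=> cf cg x; apply: cvg_pair; [exact: cf|exact: cg]. Qed.

Lemma measurable_fun_pair_in {d d1 d2} {T : measurableType d}
    {T1 : measurableType d1} {T2 : measurableType d2} (D : set T)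
    (f : T -> T1) (g : T -> T2) : measurable D ->
  measurable_fun D f -> measurable_fun D g ->
  measurable_fun D (fun x => (f x, g x)).
Proof.
move=> mD /(measurable_restrictT _ mD) mf /(measurable_restrictT _ mD) mg.
apply/(measurable_restrictT _ mD).
rewrite (_ : _ \_ _ = fun x => ((f \_ D) x, (g \_ D) x)).
  exact: measurable_fun_pair.
by apply/funext => x; rewrite /patch; case: ifP.
Qed.

Lemma uniform_prob_ae {R : realType} (a b : R) (ab : a < b)
    (Q : measurableTypeR R -> Prop) :
  {ae uniform_prob ab, forall t, a <= (t : R) <= b -> Q t} ->
  {ae lebesgue_measure, forall t : measurableTypeR R, a <= (t : R) <= b -> Q t}.
Proof.
move=> [N [mN N0 QN]]; exists (N `&` `[a, b]%classic); split.
- by apply: measurableI => //; exact: measurable_itv.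
(* The uniform law of [N] is the Lebesgue measure of its part in [[a, b]] times the nonzero factor
   [1/(b - a)]. *)
- have := integral_uniform ab (f := fun x => (\1_N x)%:E).
  rewrite (integral_indic (uniform_prob ab))// integral_indic// setIT => H.
  have mN1 : measurable_fun setT (fun x => (\1_N x : R)%:E).
    by apply/measurable_EFinP; exact: measurable_indic.
  have N1 x : (0 <= (\1_N x : R)%:E)%E by rewrite lee_fin.
  have /esym/eqP := etrans (esym N0) (H mN1 N1).
  rewrite mule_eq0 eqe invr_eq0 subr_eq0 gt_eqF//= => /eqP; exact.
- move=> t nQ; have tab : a <= t <= b by apply: contrapT => tab; apply: nQ => /tab.
  split; last by rewrite /= in_itv.
  by apply: QN => h; apply: nQ => _; exact: h.
Qed.

(** * The pointwise minimizer along the flow *)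

Section velocity_consistency.
Context {R : realType} {d : nat}.
Local Notation E := (measurableTypeR R * 'rV[R]_d)%type.

Definition slab (a b : R) : set (R * 'rV[R]_d) := [set z | a <= z.1 <= b].

Lemma closed_slab a b : closed (slab a b).
Proof.
have -> : slab a b = fst @^-1` [set` `[a, b]].
  by apply/seteqP; split => z; rewrite /slab /= in_itv.
apply: preimage_closed; last exact: interval_closed.
by move=> z _; exact: cvg_fst.
Qed.

Lemma measurable_slab a b : measurable (slab a b : set E).
Proof. by apply: closed_measurable_prod; exact: closed_slab. Qed.

Variables (psi v w : R -> 'rV[R]_d -> 'rV[R]_d) (P : probability 'rV[R]_d R).
Hypothesis psi_continuous :
  {within slab 0 1, continuous (fun z => psi z.1 z.2)}.
Hypothesis psi_injective : forall t, 0 <= t <= 1 -> injective (psi t).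
Variables (S T dt alpha : R).
Hypotheses (S_ge0 : 0 <= S) (T_le1 : T <= 1) (dt_gt0 : 0 < dt) (alpha_gt0 : 0 < alpha).
Hypothesis hdt : S < T - dt.
Hypotheses (mv : measurable_field S T v) (mw : measurable_field S T w).

Let A := slab S (T - dt).
Let leTB : T - dt <= T. Proof. by rewrite gerBl ltW. Qed.
Let A01 z : A z -> slab 0 1 z.
Proof.
move=> /andP[Sz zT]; apply/andP; split; first exact: le_trans Sz.
exact: le_trans zT (le_trans leTB T_le1).
Qed.
Let AST z : A z -> slab S T z.
Proof. by move=> /andP[Sz zT]; apply/andP; split=> //; exact: le_trans zT leTB. Qed.
Let shift (z : R * 'rV[R]_d) : R * 'rV[R]_d := (z.1 + dt, z.2).
Let shiftST z : A z -> slab S T (shift z).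
Proof.
move=> /andP[Sz zT]; apply/andP; split; last by rewrite /= -lerBrDr.
by rewrite (le_trans Sz)// lerDl ltW.
Qed.
Let shift01 z : A z -> slab 0 1 (shift z).
Proof.
move=> /shiftST/andP[Sz zT]; apply/andP; split; first exact: le_trans Sz.
exact: le_trans zT T_le1.
Qed.
Let mA : measurable (A : set E). Proof. exact: measurable_slab. Qed.

Let flow z := (z.1, psi z.1 z.2).

(** The second component of [z] is the starting point x_0, not the position at time [z.1]. *)
Definition target (z : R * 'rV[R]_d) : 'rV[R]_d :=
  loss_minimizer alpha (T - z.1) (T - (z.1 + dt))
    (psi (z.1 + dt) z.2 - psi z.1 z.2) (w (z.1 + dt) (psi (z.1 + dt) z.2)).

Lemma flow_continuous : {within slab 0 1, continuous flow}.
Proof.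
apply: within_continuous_pair => //.
by apply: continuous_subspaceT => z; exact: cvg_fst.
Qed.

Lemma shift_continuous : {within A, continuous shift}.
Proof.
apply: within_continuous_pair; apply: continuous_subspaceT => z; last exact: cvg_snd.
by apply: (@cvgD _ R); [exact: cvg_fst|exact: cvg_cst].
Qed.

Lemma flowA_continuous : {within A, continuous flow}.
Proof. exact: continuous_subspaceW A01 flow_continuous. Qed.

Lemma flow_shift_continuous : {within A, continuous (flow \o shift)}.
Proof. exact: within_continuous_comp_in shift_continuous shift01 flow_continuous. Qed.

Lemma psiA_continuous : {within A, continuous (fun z => psi z.1 z.2)}.
Proof. exact: continuous_subspaceW A01 psi_continuous. Qed.

Lemma psi_shift_continuous : {within A, continuous (fun z => psi (z.1 + dt) z.2)}.
Proof. exact: within_continuous_comp_in shift_continuous shift01 psi_continuous. Qed.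

Lemma measurable_fst_in : measurable_fun (A : set E) (fun z => z.1).
Proof. by apply: measurable_funTS; exact: measurable_fst. Qed.

Lemma measurable_along_flow (f : R -> 'rV[R]_d -> 'rV[R]_d) (h : E -> E) :
  measurable_field S T f -> measurable_fun (A : set E) h ->
  (forall z, A z -> slab S T (h z)) ->
  measurable_fun (A : set E) (fun z => f (h z).1 (h z).2).
Proof.
move=> mf mh hA; apply: (measurable_comp _ _ mf mh).
  exact: measurable_slab.
by move=> _ [z Az <-]; exact: hA.
Qed.

Lemma measurable_v_flow : measurable_fun (A : set E) (fun z => v z.1 (psi z.1 z.2)).
Proof.
apply: (measurable_along_flow v flow) => //.
apply: measurable_fun_pair_in => //; first exact: measurable_fst_in.
by apply: continuous_measurable_prod psiA_continuous; exact: closed_slab.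
Qed.

Lemma measurable_shift_time :
  measurable_fun (A : set E) (fun z => z.1 + dt : measurableTypeR R).
Proof. by apply: measurable_funD => //; exact: measurable_fst_in. Qed.

Lemma measurable_w_flow :
  measurable_fun (A : set E) (fun z => w (z.1 + dt) (psi (z.1 + dt) z.2)).
Proof.
apply: (measurable_along_flow w (flow \o shift)) => //.
apply: measurable_fun_pair_in => //; first exact: measurable_shift_time.
by apply: continuous_measurable_prod psi_shift_continuous; exact: closed_slab.
Qed.

Lemma measurable_psi : measurable_fun (A : set E) (fun z => psi z.1 z.2).
Proof. by apply: continuous_measurable_prod psiA_continuous; exact: closed_slab. Qed.

Lemma measurable_psi_shift : measurable_fun (A : set E) (fun z => psi (z.1 + dt) z.2).
Proof. by apply: continuous_measurable_prod psi_shift_continuous; exact: closed_slab. Qed.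

(** The coefficients of [target] as functions of time, continuous because [alpha > 0] keeps their
    denominator positive. *)
Let k1 (t : R) : R := (T - t) / ((T - t) ^+ 2 + alpha).
Let k2 (t : R) : R := ((T - t) * (T - (t + dt)) + alpha) / ((T - t) ^+ 2 + alpha).

Let denom_gt0 t : 0 < (T - t) ^+ 2 + alpha.
Proof. by rewrite ltr_wpDl// sqr_ge0. Qed.

Lemma k1_continuous : continuous k1.
Proof.
move=> t; apply: cvgM.
  by apply: cvgB; [exact: cvg_cst|exact: cvg_id].
apply: cvgV; first by rewrite gt_eqF.
apply: cvgD; last exact: cvg_cst.
by apply: cvgM; (apply: cvgB; [exact: cvg_cst|exact: cvg_id]).
Qed.

Lemma k2_continuous : continuous k2.
Proof.
move=> t; apply: cvgM.
  apply: cvgD; last exact: cvg_cst.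
  apply: cvgM; apply: cvgB; [exact: cvg_cst|exact: cvg_id|exact: cvg_cst|].
  by apply: cvgD; [exact: cvg_id|exact: cvg_cst].
apply: cvgV; first by rewrite gt_eqF.
apply: cvgD; last exact: cvg_cst.
by apply: cvgM; (apply: cvgB; [exact: cvg_cst|exact: cvg_id]).
Qed.

Lemma measurable_target : measurable_fun (A : set E) target.
Proof.
have mk (k : R -> R) : continuous k ->
    measurable_fun (A : set E) (fun z => k z.1 : measurableTypeR R).
  by move=> /continuous_measurable_fun mk; exact: measurableT_comp mk measurable_fst_in.
apply: (measurable_rV_lin mA (fun z => k1 z.1) (fun z => k2 z.1)).
- exact: mk k1_continuous.
- by apply: measurable_rVB => //; [exact: measurable_psi_shift|exact: measurable_psi].
- exact: mk k2_continuous.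
- exact: measurable_w_flow.
Qed.

Lemma target_continuous : continuous_field S T w -> {within A, continuous target}.
Proof.
move=> cw.
have cwf : {within A, continuous (fun z => w (z.1 + dt) (psi (z.1 + dt) z.2))}.
  exact: (within_continuous_comp_in _ _ _ _ flow_shift_continuous shiftST cw).
have ck (k : R -> R) : continuous k -> {within A, continuous (fun z => k z.1)}.
  move=> ck; apply: continuous_subspaceT => z.
  by apply: (@continuous_comp _ _ _ fst k); [exact: cvg_fst|exact: ck].
move=> z; apply: cvgD; apply: cvgZ.
- exact: ck k1_continuous z.
- by apply: cvgB; [exact: psi_shift_continuous|exact: psiA_continuous].
- exact: ck k2_continuous z.
- exact: cwf.
Qed.

(** * Least value and excess of the objective *)

Let excess (z : R * 'rV[R]_d) : R :=
  ((T - z.1) ^+ 2 + alpha) * sqnorm2 (v z.1 (psi z.1 z.2) - target z).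
Let least (z : R * 'rV[R]_d) : R :=
  pair_loss T dt alpha (fun _ _ => target z) w z.1 (psi z.1 z.2) (psi (z.1 + dt) z.2).

Lemma measurable_excess : measurable_fun (A : set E) excess.
Proof.
apply: measurable_funM.
  apply: measurable_funD => //; apply: measurable_funX.
  by apply: measurable_funB => //; exact: measurable_fst_in.
apply: measurable_sqnorm2 => //; apply: measurable_rVB => //.
  exact: measurable_v_flow.
exact: measurable_target.
Qed.

Lemma measurable_least : measurable_fun (A : set E) least.
Proof.
have mc (c : R) : measurable_fun (A : set E) (fun=> c : measurableTypeR R).
  exact: measurable_cst.
have mend (f g : E -> 'rV[R]_d) (k : E -> measurableTypeR R) :
    measurable_fun (A : set E) f -> measurable_fun (A : set E) g ->
    measurable_fun (A : set E) k ->
    measurable_fun (A : set E) (fun z => f z + (k z : R) *: g z).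
  move=> mf mg mk; under eq_fun do rewrite -[X in X + _]scale1r.
  exact: measurable_rV_lin.
apply: measurable_funD; last first.
  apply: measurable_funM => //; apply: measurable_sqnorm2 => //.
  by apply: measurable_rVB => //; [exact: measurable_target|exact: measurable_w_flow].
apply: measurable_sqnorm2 => //; apply: measurable_rVB => //; apply: mend.
- exact: measurable_psi.
- exact: measurable_target.
- by apply: measurable_funB => //; exact: measurable_fst_in.
- exact: measurable_psi_shift.
- exact: measurable_w_flow.
- by apply: measurable_funB => //; exact: measurable_shift_time.
Qed.

Lemma excess_ge0 z : 0 <= excess z.
Proof. by rewrite mulr_ge0 ?sqnorm2_ge0// addr_ge0 ?sqr_ge0// ltW. Qed.

Lemma least_ge0 z : 0 <= least z.
Proof. by rewrite addr_ge0 ?mulr_ge0 ?sqnorm2_ge0// ltW. Qed.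

(* The position at time t determines the trajectory, so that the pointwise
   minimizer is a function of (t, x_t). *)
Lemma target_field : exists2 m : R -> 'rV[R]_d -> 'rV[R]_d, measurable_field S T m &
  forall z, A z -> m z.1 (psi z.1 z.2) = target z.
Proof.
have flow_inj : {in A &, injective flow}.
  move=> [t x] [t' x'] /[!inE] /A01 /= t01 _ [tt' xx']; rewrite -tt' in xx' *.
  by congr pair; exact: psi_injective xx'.
have [g mg gK] := measurable_left_inverse _ _ (closed_slab _ _) flowA_continuous flow_inj.
(* Here [g] recovers x_0 from the time and the position. Extension of [target] by 0 off [A] gives a
   field that is measurable everywhere. *)
exists (fun t x => (target \_ A) (t, g (t, x))); last first.
  by move=> [t x] Az; rewrite /= (gK (t, x) Az) patchE mem_set.
apply: (@measurable_funS _ _ _ _ setT) => //.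
apply: (measurableT_comp (f := target \_ A)).
  by apply/(measurable_restrictT _ mA); exact: measurable_target.
apply: measurable_fun_pair; first exact: measurable_fst.
by under eq_fun do rewrite -surjective_pairing.
Qed.

Lemma minimizer_along_flow (lambda : R) : 0 < lambda ->
  (objective hdt alpha lambda P psi v w < +oo)%E ->
  (forall m, measurable_field S T m ->
    (objective hdt alpha lambda P psi v w <= objective hdt alpha lambda P psi m w)%E) ->
  {ae lebesgue_measure, forall t : measurableTypeR R, S <= (t : R) <= T - dt ->
    {ae P, forall x, v t (psi t x) = target (t, x)}}.
Proof.
move=> lambda0 vfin vmin.
have AE : A = `[S, T - dt]%classic `*` setT.
  by apply/seteqP; split => z /=; rewrite /A /slab /= in_itv => // -[].
have [m mm mtarget] := target_field.
have objE : objective hdt alpha lambda P psi v w =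
    (\int[uniform_prob hdt]_(t in `[S, (T - dt)%R])
       (lambda%:E * \int[P]_x ((least \+ excess)%R (t, x))%:E))%E.
  apply: eq_integral => t /[!inE] /= tST; congr (_ * _)%E.
  by apply: eq_integral => x _; rewrite pair_loss_split.
(* Along the flow [m] takes the values of [target], so its loss is [least] alone. *)
have objmE : objective hdt alpha lambda P psi m w =
    (\int[uniform_prob hdt]_(t in `[S, (T - dt)%R])
       (lambda%:E * \int[P]_x (least (t, x))%:E))%E.
  apply: eq_integral => t /[!inE] /= tST; congr (_ * _)%E.
  apply: eq_integral => x _; rewrite /least /pair_loss /endpoint /=.
  by rewrite (mtarget (t, x))// /A /slab /=; move: tST; rewrite in_itv.
have := vmin m mm; rewrite objmE objE => le_obj; rewrite objE in vfin.
apply: (uniform_prob_ae _ _ hdt).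
have mleast : measurable_fun (`[S, T - dt]%classic `*` setT) (least : E -> R).
  by rewrite -AE; exact: measurable_least.
have mexcess : measurable_fun (`[S, T - dt]%classic `*` setT) (excess : E -> R).
  by rewrite -AE; exact: measurable_excess.
have := iterated_integral_slack (uniform_prob hdt) P _ (measurable_itv _) _ _ _
  lambda0 mleast mexcess least_ge0 excess_ge0 le_obj vfin.
apply: filterS => t ht tST; have := ht _; rewrite /= in_itv => /(_ tST).
apply: filterS => x /eqP; rewrite /excess /= mulf_eq0 (gt_eqF (denom_gt0 t)) /=.
by move=> /eqP/sqnorm2_eq0/eqP; rewrite subr_eq0 => /eqP.
Qed.

(** * From almost every starting point to the support of the law *)

Lemma open_measurable_rV (U : set 'rV[R]_d) : open U -> measurable U.
Proof.
move=> oU.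
(* [U] is the section over time 0 of this open subset of the product. *)
have oTU : open (snd @^-1` U : set (R * 'rV[R]_d)).
  by apply: open_comp oU => z _; exact: cvg_snd.
have := pair1_measurable (0 : measurableTypeR R) measurableT (open_measurable_prod _ oTU).
by rewrite setTI.
Qed.

(** If [F] is nonzero at [(t, x)], it is nonzero on a neighborhood of that point in the slab. Each
    time close to [t] is then exceptional, since the starting points near [x] have positive mass,
    and these times fill an interval of positive length. *)
Lemma ae_eq_on_support (F : R * 'rV[R]_d -> 'rV[R]_d) :
  {within A, continuous F} ->
  {ae lebesgue_measure, forall t : measurableTypeR R, S <= (t : R) <= T - dt ->
    {ae P, forall x, F (t, x) = 0}} ->
  forall t x, S <= t <= T - dt -> law_support P x -> F (t, x) = 0.
Proof.
move=> /subspace_continuousP cF [N [mN N0 FN]] t x tST Px.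
apply: contrapT => Ftx.
have nz : nbhs (F (t, x)) [set y : 'rV[R]_d | y <> 0].
  apply: open_nbhs_nbhs; split => //.
  rewrite (_ : [set _ | _] = ~` [set 0])//; apply: closed_openC.
  by apply: accessible_closed_set1; apply: hausdorff_accessible; exact: norm_hausdorff.
have [[U V] /= [Ut Vx] UV] := cF (t, x) tST _ nz.
move: Ut => /nbhs_ballP[e /= e0 eU].
move: Vx; rewrite nbhsE => -[W [oW Wx] WV].
(* Clipping to [[S, T - dt]] keeps [a < b] even when [t] is an endpoint; the half radius puts the
   closed interval inside the open ball. *)
pose a := Num.max S (t - e / 2); pose b := Num.min (T - dt) (t + e / 2).
have e20 : 0 < e / 2 by rewrite divr_gt0.
have [St tT] := andP tST.
have ab : a < b.
  rewrite lt_min !gt_max hdt/=; apply/and3P; split.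
  - by rewrite (lt_le_trans _ tT)// gtrBl.
  - by rewrite (le_lt_trans St)// ltrDl.
  - by rewrite ltrD2l gtrN.
have abN : `[a, b]%classic `<=` N.
  move=> s /=; rewrite in_itv/= ge_max le_min => /andP[/andP[Ss ts] /andP[sT st]].
  apply: contrapT => sN; apply: sN; apply: FN => /= Fs.
  have [|M [mM M0 FM]] := Fs _; first by rewrite Ss.
  (* [W] has positive mass, so it cannot lie in the null set [M]. *)
  have := Px W oW Wx.
  rewrite (subset_measure0 (open_measurable_rV _ oW) mM _ M0) ?ltxx// => y Wy.
  apply: FM => /= Fsy.
  suff : F (s, y) <> 0 by [].
  apply: (UV (s, y)); last by rewrite /A /slab /= Ss.
  split; last exact: WV.
  apply: eU; rewrite /= /ball /= distrC ltr_norml.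
  have e2e : e / 2 < e by rewrite gtr_pMr// invf_lt1// ltr1n.
  apply/andP; split.
    by rewrite ltrBrDl (lt_le_trans _ ts)// ltrD2l ltrN2.
  by rewrite ltrBlDl (le_lt_trans st)// ltrD2l.
have := @subset_measure0 _ _ R (@lebesgue_measure R) _ _ (measurable_itv _) mN abN N0.
rewrite /= lebesgue_measure_itv/= lte_fin ab -EFinD => -[] /eqP.
by rewrite subr_eq0 gt_eqF.
Qed.

Lemma minimizer_on_support :
  continuous_field S T v -> continuous_field S T w ->
  {ae lebesgue_measure, forall t : measurableTypeR R, S <= (t : R) <= T - dt ->
    {ae P, forall x, v t (psi t x) = target (t, x)}} ->
  forall t x, S <= t <= T - dt -> law_support P x -> v t (psi t x) = target (t, x).
Proof.
move=> cv cw vt t x tST Px; apply/eqP; rewrite -subr_eq0; apply/eqP.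
apply: (ae_eq_on_support (fun z => v z.1 (psi z.1 z.2) - target z)) => //.
  have cvf : {within A, continuous (fun z => v z.1 (psi z.1 z.2))}.
    exact: (within_continuous_comp_in _ _ _ _ flowA_continuous AST cv).
  by move=> z; apply: cvgB; [exact: cvf|exact: target_continuous].
apply: filterS vt => s vs sST; have := vs sST; apply: filterS => y ->.
by rewrite subrr.
Qed.

End velocity_consistency.

(** * Limit of the moving average and the error formula *)

Lemma ema_limit {R : realType} {V : normedModType R} (mu : R) (th_ thm_ : nat -> V)
    (th thm : V) : mu < 1 -> ema mu th_ thm_ ->
  th_ n @[n --> \oo] --> th -> thm_ n @[n --> \oo] --> thm -> thm = th.
Proof.
move=> mu1 hema cth cthm.
have cS : thm_ n.+1 @[n --> \oo] --> thm by rewrite (cvg_shiftS thm_).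
(* In the limit the recursion becomes a fixed-point equation, whose only solution is [th] since
   [1 - mu] is nonzero. *)
have cR : thm_ n.+1 @[n --> \oo] --> mu *: thm + (1 - mu) *: th.
  under eq_cvg do rewrite hema.
  by apply: cvgD; apply: cvgZl_tmp => //; rewrite (cvg_shiftS th_).
have thmE : thm = mu *: thm + (1 - mu) *: th.
  exact: norm_cvg_unique cS cR.
have /eqP : (1 - mu) *: (thm - th) = 0.
  by rewrite scalerBr scalerBl scale1r -addrA -opprD -thmE subrr.
by rewrite scaler_eq0 subr_eq0 gt_eqF//= subr_eq0 => /eqP.
Qed.

Theorem theorem2 (R : realType) (d : nat)
    (* probability path, its velocity field and the flow of that field *)
    (u : R -> 'rV[R]_d -> 'rV[R]_d) (p : R -> 'rV[R]_d -> R)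
    (psi : R -> 'rV[R]_d -> 'rV[R]_d) (P : probability 'rV[R]_d R)
    (hgen : generates u psi P p)
    (hcont : continuity_equation u p)
    (* segment i and the constants of the objective *)
    (K : nat) (i : 'I_K) (dt : R) (dt_gt0 : 0 < dt)
    (hdt : seg_start R i < seg_end R i - dt)
    (alpha : R) (alpha_gt0 : 0 < alpha)
    (lambda : 'I_K -> R) (lambda_gt0 : forall j, 0 < lambda j)
    (* oracle consistent velocity *)
    (vstar : R -> 'rV[R]_d -> 'rV[R]_d)
    (hstar : oracle_velocity (seg_start R i) (seg_end R i) psi vstar)
    (* parametrized fields *)
    (Theta : normedModType R)
    (v : 'I_K -> Theta -> R -> 'rV[R]_d -> 'rV[R]_d)
    (hmeas : forall th, measurable_field (seg_start R i) (seg_end R i) (v i th))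
    (* training: th is the learned parameter, thm its moving average *)
    (mu : R) (hmu : 0 <= mu < 1) (th_ thm_ : nat -> Theta)
    (hema : ema mu th_ thm_) (th thm : Theta)
    (hth : th_ n @[n --> \oo] --> th) (hthm : thm_ n @[n --> \oo] --> thm)
    (* th minimizes the objective of segment i for the target thm, and the
       family is expressive enough for its infimum to be that over all fields *)
    (hfin : (objective hdt alpha (lambda i) P psi (v i th) (v i thm) < +oo)%E)
    (hmin : forall th',
      (objective hdt alpha (lambda i) P psi (v i th) (v i thm) <=
       objective hdt alpha (lambda i) P psi (v i th') (v i thm))%E)
    (hrich : forall w, measurable_field (seg_start R i) (seg_end R i) w ->
      (ereal_inf (range (fun th' =>
         objective hdt alpha (lambda i) P psi (v i th') (v i thm))) <=
       objective hdt alpha (lambda i) P psi w (v i thm))%E) :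
  let S := seg_start R i in
  let T := seg_end R i in
  let error_formula (t : R) (x0 : 'rV[R]_d) : Prop :=
    let x := psi t x0 in
    let x' := psi (t + dt) x0 in
    v i th t x - vstar t x =
      (alpha / ((T - t) ^+ 2 + alpha)) *: (vstar (t + dt) x' - vstar t x) +
      (((T - t - dt) * (T - t) + alpha) / ((T - t) ^+ 2 + alpha)) *:
        (v i th (t + dt) x' - vstar (t + dt) x') in
  {ae lebesgue_measure, forall t : measurableTypeR R, S <= (t : R) <= T - dt ->
    {ae P, forall x0, error_formula t x0}} /\
  (continuous_field S T (v i th) ->
    forall t x0, S <= t <= T - dt -> law_support P x0 -> error_formula t x0).
Proof.
move=> S T error_formula.
have [[_ psi_cont _ psi_inj] _] := hgen.
have K0 : 0 < K%:R :> R by rewrite ltr0n (leq_ltn_trans _ (ltn_ord i)).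
have S0 : 0 <= S by rewrite /S /seg_start divr_ge0.
have T1 : T <= 1 by rewrite /T /seg_end ler_pdivrMr// mul1r ler_nat.
have [_ mu1] := andP hmu.
have thmE : thm = th := ema_limit mu th_ thm_ th thm mu1 hema hth hthm.
rewrite {}thmE in hfin hmin hrich.
(* [hmin] makes the value at [th] a lower bound of the infimum over parameters; [hrich] carries this
   bound to every measurable field. *)
have le_obj m : measurable_field S T m ->
    (objective hdt alpha (lambda i) P psi (v i th) (v i th) <=
     objective hdt alpha (lambda i) P psi m (v i th))%E.
  move=> mm; apply: le_trans (hrich m mm).
  by apply: le_ereal_inf_tmp => _ [th' _ <-]; exact: hmin.
have along_flow := minimizer_along_flow psi (v i th) (v i th) P psi_cont psi_inj
  S T dt alpha S0 T1 dt_gt0 alpha_gt0 hdt (hmeas th) (hmeas th) (lambda i)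
  (lambda_gt0 i) hfin le_obj.
have error_of_target t x0 : S <= t <= T - dt ->
    v i th t (psi t x0) = target psi (v i th) T dt alpha (t, x0) ->
    error_formula t x0.
  move=> /andP[St tT] vt; rewrite /error_formula /= vt.
  (* Both [t] and [t + dt] lie in the segment, so the oracle joins both positions to the same
     endpoint [psi T x0]. *)
  have tdT : t + dt <= T by rewrite -lerBrDr.
  have ttd : t <= t + dt by rewrite lerDl ltW.
  apply: (loss_minimizer_error alpha T t dt _ _ (psi T x0)) => //.
    by apply: hstar; rewrite St (le_trans ttd).
  by apply: hstar; rewrite tdT (le_trans St).
split.
  apply: filterS along_flow => t vt tST; apply: filterS (vt tST) => x0.
  exact: error_of_target.
move=> cv t x0 tST Px0; apply: error_of_target => //.
exact: (minimizer_on_support psi (v i th) (v i th) P psi_cont S T dt alpha).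
Qed.
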